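(* Let $T:\mathbb{Z}^d\curvearrowright(X,\Sigma,\mu)$ be a $\mathbb{Z}^d$-system and let $\mu^{\mathrm F}$ be the Furstenberg self-joining of $T^{\mathbf e_1},\dots,T^{\mathbf e_d}$. If $A_1,\dots,A_d\in\Sigma$ satisfy $\mu^{\mathrm F}(A_1\times A_2\times\cdots\times A_d)=0$, then $\mu(A_1\cap A_2\cap\cdots\cap A_d)=0$.
   Context: A $\mathbb{Z}^d$-system is a standard Borel probability space $(X,\Sigma,\mu)$ with an action $T$ of $\mathbb{Z}^d$ by invertible measurable $\mu$-preserving maps; $\mathbf e_1,\dots,\mathbf e_d$ is the standard basis. The Furstenberg self-joining $\mu^{\mathrm F}$ is the probability measure on $(X^d,\Sigma^{\otimes d})$ determined by \[\mu^{\mathrm F}(A_1\times\cdots\times A_d)=\lim_{N\to\infty}\frac1N\sum_{n=1}^N\mu\big(T^{-n\mathbf e_1}(A_1)\cap\cdots\cap T^{-n\mathbf e_d}(A_d)\big)\] for all $A_1,\dots,A_d\in\Sigma$ (these limits exist). *)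

(* Defs.v *)
From HB Require Import structures.
From mathcomp Require Import all_boot all_order all_algebra.
From mathcomp Require Import all_classical all_reals all_analysis.
Set Implicit Arguments. Unset Strict Implicit. Unset Printing Implicit Defensive.
Import Order.TTheory GRing.Theory Num.Theory.
Local Open Scope classical_set_scope.
Local Open Scope ring_scope.

Definition basis_vec (d : nat) (i : 'I_d) : 'rV[int]_d := delta_mx 0 i.

(* A Z^d-action T on (X, Sigma, mu) by measurable, mu-preserving maps.
   Invertibility of each T^u follows from the group-action laws
   (T^(-u) is a measurable inverse). *)
Definition Zd_system (R : realType) (disp : measure_display)
  (X : measurableType disp) (mu : probability X R) (d : nat)
  (T : 'rV[int]_d -> X -> X) : Prop :=
  [/\ forall x, T 0 x = x,
      forall u v x, T (u + v) x = T u (T v x),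
      forall u, measurable_fun setT (T u) &
      forall u (A : set X), measurable A -> mu (T u @^-1` A) = mu A].

(* (X, Sigma) is a standard Borel space: it is Borel-isomorphic to a Borel
   subset of the real line (Kuratowski). *)
Definition standard_borel (R : realType) (disp : measure_display)
  (X : measurableType disp) : Prop :=
  exists f : X -> R,
    [/\ injective f, measurable_fun setT f, measurable (range f) &
        forall A : set X, measurable A -> measurable (f @` A)].

(* The measurable rectangle A_1 x ... x A_d in X^d (X^d = d.-tuple X with
   the product sigma-algebra provided by MathComp-Analysis). *)
Definition rect (disp : measure_display) (X : measurableType disp) (d : nat)
  (A : 'I_d -> set X) : set (d.-tuple X) :=
  [set x | forall i, A i (tnth x i)].

Definition furstenberg_avg (R : realType) (disp : measure_display)
  (X : measurableType disp) (mu : probability X R) (d : nat)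
  (T : 'rV[int]_d -> X -> X) (A : 'I_d -> set X) (N : nat) : R :=
  (N%:R)^-1 * \sum_(1 <= n < N.+1)
     fine (mu (\bigcap_(i in [set: 'I_d]) (T (basis_vec i *+ n) @^-1` A i))).

Definition furstenberg_joining (R : realType) (disp : measure_display)
  (X : measurableType disp) (mu : probability X R) (d : nat)
  (T : 'rV[int]_d -> X -> X) (muF : {measure set (d.-tuple X) -> \bar R}) : Prop :=
  forall A : 'I_d -> set X, (forall i, measurable (A i)) ->
    (fun N => (furstenberg_avg mu T A N)%:E) @ \oo --> muF (rect A).

(* Main.v *)
(** It suffices to bound from below the averages of [mu (simplex B m)], where [B] is
    the intersection of the [A i], [mu B > 0], and [simplex B m] is the set of the
    points moved into [B] by every [T (m e_i)].  Such a bound follows from the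
    density Hales-Jewett theorem for the alphabet ['I_d]: for a fixed [n], send a word
    [w] of length [N] to the vector [n (e_(w_1) + .. + e_(w_N))].  For a set of
    points [x] of measure bounded below, the words whose vector moves [x] into [B] are
    dense, hence contain a combinatorial line, that is, a point of [simplex B (n r)]
    up to translation, with [1 <= r <= N].

    The density Hales-Jewett theorem is proved by induction on the alphabet,
    following the density increment strategy of Polymath and of Dodos,
    Kanellopoulos and Tyros.  Words over [option L] are read both as words over the
    larger alphabet and as lines over [L], [None] being the wildcard.  If [A] has
    no line, then it meets the set of its own [L]-lines in a negligible set, while
    this set is an intersection of insensitive sets and is not small; so [A] is
    denser than average on a cell of the complement, which is almost a disjoint
    union of large subspaces.  At the critical density this is a contradiction. *)

Require Import Defs.
From HB Require Import structures.
From mathcomp Require Import all_boot all_order all_algebra.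
From mathcomp Require Import all_classical all_reals all_analysis.
From mathcomp Require Import measurable_realfun lra ring.
Import Order.TTheory GRing.Theory Num.Theory.
Import numFieldNormedType.Exports.
Set Implicit Arguments.
Unset Strict Implicit.
Unset Printing Implicit Defensive.
Local Open Scope ring_scope.

(** * Averages and words *)

Section Average.
Variable R : realType.

Definition avg (T : finType) (f : T -> R) : R := (\sum_x f x) / #|T|%:R.

Lemma eq_avg (T : finType) (f g : T -> R) : f =1 g -> avg f = avg g.
Proof. by move=> fg; rewrite /avg (eq_bigr g). Qed.

Lemma le_avg (T : finType) (f g : T -> R) :
  (forall x, f x <= g x) -> avg f <= avg g.
Proof.
by move=> fg; rewrite /avg ler_wpM2r ?invr_ge0 ?ler0n// ler_sum.
Qed.

Lemma avgD (T : finType) (f g : T -> R) :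
  avg (fun x => f x + g x) = avg f + avg g.
Proof. by rewrite /avg big_split /= mulrDl. Qed.

Lemma avgZ (T : finType) c (f : T -> R) : avg (fun x => c * f x) = c * avg f.
Proof. by rewrite /avg -big_distrr /= mulrA. Qed.

Lemma avgZr (T : finType) c (f : T -> R) : avg (fun x => f x * c) = avg f * c.
Proof. by rewrite /avg -big_distrl /= mulrAC. Qed.

Lemma avgB (T : finType) (f g : T -> R) :
  avg (fun x => f x - g x) = avg f - avg g.
Proof.
rewrite -mulN1r -avgZ -avgD; apply: eq_avg => x; by rewrite mulN1r.
Qed.

Lemma avg_sum (T J : finType) (f : J -> T -> R) :
  avg (fun x => \sum_j f j x) = \sum_j avg (f j).
Proof. by rewrite /avg exchange_big /= big_distrl. Qed.

Lemma avg_cst (T : finType) (x0 : T) c : avg (fun _ : T => c) = c.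
Proof.
rewrite /avg sumr_const -[c *+ _]mulr_natr mulfK// pnatr_eq0 -lt0n.
by apply/card_gt0P; exists x0.
Qed.

Lemma avg_ge0 (T : finType) (f : T -> R) : (forall x, 0 <= f x) -> 0 <= avg f.
Proof. by move=> f0; rewrite divr_ge0// sumr_ge0. Qed.

Lemma avg_le_cst (T : finType) (f : T -> R) c :
  0 <= c -> (forall x, f x <= c) -> avg f <= c.
Proof.
move=> c0 fc; case: (pickP (fun _ : T => true)) => [x0 _|T0].
  by rewrite -[leRHS](avg_cst x0); exact: le_avg.
by rewrite /avg big_pred0 ?mul0r.
Qed.

Lemma avg_gt_ex (T : finType) (f : T -> R) c :
  0 <= c -> c < avg f -> exists x, c < f x.
Proof.
move=> c0 cf; apply: contrapT => nex.
suff : avg f <= c by rewrite leNgt cf.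
apply: avg_le_cst => // x; rewrite leNgt; apply/negP => xc.
by apply: nex; exists x.
Qed.

Lemma avg_ge_ex (T : finType) (x0 : T) (f : T -> R) c :
  c <= avg f -> exists x, c <= f x.
Proof.
move=> cf; apply: contrapT => nex.
have fc x : f x < c.
  by rewrite ltNge; apply/negP => xc; apply: nex; exists x.
suff : avg f < c by rewrite ltNge cf.
rewrite /avg ltr_pdivrMr; last first.
  by rewrite ltr0n; apply/card_gt0P; exists x0.
rewrite mulr_natr -sumr_const; apply: ltr_sum => //.
by apply/hasP; exists x0 => //; rewrite mem_index_enum.
Qed.

Lemma avg_ge_term (T : finType) (f : T -> R) x :
  (forall y, 0 <= f y) -> f x / #|T|%:R <= avg f.
Proof.
move=> f0; rewrite ler_wpM2r ?invr_ge0 ?ler0n//.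
by rewrite (bigD1 x)//= lerDl sumr_ge0.
Qed.

Lemma avg_pair (T1 T2 : finType) (f : T1 * T2 -> R) :
  avg f = avg (fun x => avg (fun y => f (x, y))).
Proof.
rewrite /avg -big_distrl /= pair_bigA /= card_prod natrM invfM.
rewrite [_^-1 * _^-1]mulrC mulrA; congr (_ / _ / _).
by apply: eq_bigr => -[].
Qed.

Lemma avg_exchange (T1 T2 : finType) (f : T1 -> T2 -> R) :
  avg (fun x => avg (f x)) = avg (fun y => avg (f^~ y)).
Proof.
rewrite /avg -!big_distrl /= exchange_big /=.
by rewrite -!mulrA [_^-1 * _^-1]mulrC.
Qed.

Lemma avg_bij (T1 T2 : finType) (h : T1 -> T2) (f : T2 -> R) :
  bijective h -> avg (f \o h) = avg f.
Proof.
move=> hb; rewrite /avg (bij_eq_card hb).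
by rewrite [in RHS](reindex h)//; exact: onW_bij.
Qed.

(** Reverse Markov inequality: [f] is pointwise at most [b] plus the indicator of [b <= f]. *)
Lemma avg_markov (T : finType) (f : T -> R) a b :
  0 <= b -> (forall x, f x <= 1) -> a + b <= avg f ->
  a <= avg (fun x => (b <= f x)%R%:R).
Proof.
move=> b0 f1 ab.
have : avg f <= avg (fun x => (b <= f x)%R%:R + b).
  by apply: le_avg => x; have := f1 x; case: (leP b (f x)) => bx /=; lra.
rewrite avgD => h; have := avg_le_cst b0 (fun _ : T => lexx b).
by move=> h'; lra.
Qed.

End Average.

(** * Words, combinatorial subspaces and lines *)

Definition word (I L : finType) : finType := {ffun I -> L}.

Section Words.
Variable R : realType.
Local Notation avg := (@avg R _).

(* A template [phi : I -> D + L] with [nondeg phi] is a combinatorial subspace of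
   [word I L] of dimension [#|D|]: [phi i = inl j] when the coordinate [i] is a copy
   of the free letter [j], and [phi i = inr a] when it is frozen to [a]. *)
Definition subst (I D L : finType) (phi : {ffun I -> D + L}) (v : word D L) :
    word I L :=
  [ffun i => match phi i with inl j => v j | inr a => a end].

Definition nondeg (I D L : finType) (phi : {ffun I -> D + L}) :=
  [forall j, exists i, phi i == inl j].

Lemma nondegP (I D L : finType) (phi : {ffun I -> D + L}) :
  reflect (forall j, exists i, phi i = inl j) (nondeg phi).
Proof.
apply: (iffP forallP) => h j; first by have /existsP[i /eqP] := h j; exists i.
by have [i ij] := h j; apply/existsP; exists i; apply/eqP.
Qed.

Definition comp_tpl (I D D' L : finType) (phi : {ffun I -> D + L})
    (psi : {ffun D -> D' + L}) : {ffun I -> D' + L} :=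
  [ffun i => match phi i with inl j => psi j | inr a => inr a end].

Lemma subst_comp (I D D' L : finType) (phi : {ffun I -> D + L})
    (psi : {ffun D -> D' + L}) v :
  subst (comp_tpl phi psi) v = subst phi (subst psi v).
Proof. by apply/ffunP => i; rewrite !ffunE; case: (phi i) => // j; rewrite ffunE. Qed.

Lemma nondeg_comp (I D D' L : finType) (phi : {ffun I -> D + L})
    (psi : {ffun D -> D' + L}) :
  nondeg phi -> nondeg psi -> nondeg (comp_tpl phi psi).
Proof.
move=> /nondegP h1 /nondegP h2; apply/nondegP => j.
have [d dj] := h2 j; have [i id] := h1 d; exists i.
by rewrite ffunE id.
Qed.

Lemma subst_inj (I D L : finType) (phi : {ffun I -> D + L}) :
  nondeg phi -> injective (subst phi).
Proof.
move=> /nondegP h v v' /ffunP vv; apply/ffunP => j.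
by have [i ij] := h j; have := vv i; rewrite !ffunE ij.
Qed.

Definition reindex_tpl (I J L : finType) (f : I -> J) : {ffun I -> J + L} :=
  [ffun i => inl (f i)].

Lemma nondeg_reindex (I J L : finType) (f : I -> J) :
  bijective f -> nondeg (reindex_tpl L f).
Proof.
by move=> [g _ fg]; apply/nondegP => j; exists (g j); rewrite ffunE fg.
Qed.

Lemma subst_reindex_bij (I J L : finType) (f : I -> J) :
  bijective f -> bijective (subst (reindex_tpl L f)).
Proof.
move=> [g gf fg]; exists (subst (reindex_tpl L g)) => v; apply/ffunP => i.
  by rewrite !ffunE fg.
by rewrite !ffunE gf.
Qed.

Definition fill (I L : finType) (a : L) (w : word I (option L)) : word I L :=
  [ffun i => odflt a (w i)].

(* The variable words over [L] are the words over [option L] in which the wildcard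
   [None] occurs. *)
Definition has_line (I L : finType) (A : pred (word I L)) :=
  [exists w : word I (option L),
    [exists i, w i == None] && [forall a, A (fill a w)]].

Lemma has_lineP (I L : finType) (A : pred (word I L)) :
  reflect (exists w : word I (option L),
    (exists i, w i = None) /\ forall a, A (fill a w)) (has_line A).
Proof.
apply: (iffP existsP) => -[w].
  by move=> /andP[/existsP[i /eqP wi] /forallP h]; exists w; split=> //; exists i.
move=> [[i wi] h]; exists w; apply/andP; split; last exact/forallP.
by apply/existsP; exists i; apply/eqP.
Qed.

Lemma has_line_subst (I D L : finType) (phi : {ffun I -> D + L})
    (A : pred (word I L)) :
  nondeg phi -> has_line (fun v => A (subst phi v)) -> has_line A.
Proof.
move=> /nondegP h /has_lineP[w [[j wj] hA]].
pose w' : word I (option L) :=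
  [ffun i => match phi i with inl j => w j | inr a => Some a end].
apply/has_lineP; exists w'; split.
  by have [i ij] := h j; exists i; rewrite ffunE ij.
move=> a; suff -> : fill a w' = subst phi (fill a w) by exact: hA.
by apply/ffunP => i; rewrite !ffunE; case: (phi i) => //= k; rewrite ffunE.
Qed.

Definition dens (I L : finType) (A : pred (word I L)) : R :=
  avg (fun w : word I L => (A w)%:R).

Lemma dens_le1 (I L : finType) (A : pred (word I L)) : dens A <= 1.
Proof. by apply: avg_le_cst => // w; rewrite lern1 leq_b1. Qed.

(** Quantifying over all large index types, rather than over one ['I_N], allows a direct application
    to any block or set of positions. *)
Definition DHJ (L : finType) (delta : R) :=
  exists N, forall I : finType, (N <= #|I|)%N ->
    forall A : pred (word I L), delta <= dens A -> has_line A.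

Definition join (I1 I2 L : finType) (x : word I1 L) (y : word I2 L) :
    word (I1 + I2)%type L :=
  [ffun i => match i with inl i => x i | inr i => y i end].

Lemma avg_join (I1 I2 L : finType) (f : word (I1 + I2)%type L -> R) :
  avg f = avg (fun x => avg (fun y => f (join x y))).
Proof.
rewrite -(avg_pair (fun p => f (join p.1 p.2))).
rewrite -(avg_bij _ (h := fun p => join p.1 p.2)) //.
exists (fun w : word (I1 + I2)%type L =>
  ([ffun i => w (inl i)], [ffun i => w (inr i)])) => [[x y]|w] /=.
  by congr pair; apply/ffunP => i; rewrite !ffunE.
by apply/ffunP => -[] i; rewrite !ffunE.
Qed.

Lemma split_index n (I : finType) : (n <= #|I|)%N ->
  exists (I1 I2 : finType) (f : I -> I1 + I2),
    [/\ bijective f, #|I1| = n & #|I2| = (#|I| - n)%N].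
Proof.
move=> nI.
pose I1 : finType := 'I_n; pose I2 : finType := 'I_(#|I| - n).
have c : #|I| = #|{: I1 + I2}| by rewrite card_sum !card_ord subnKC.
exists I1, I2, (enum_val \o cast_ord c \o enum_rank).
split; [|exact: card_ord|exact: card_ord].
apply: bij_comp; last exact: enum_rank_bij.
apply: bij_comp; first exact: enum_val_bij.
by exists (cast_ord (esym c)); [exact: cast_ordK|exact: cast_ordKV].
Qed.

Definition sub_index (I : finType) (S : pred I) : finType := {i : I | S i}.

Definition mix (I L : finType) (S : pred I) (c : word I L)
    (w : word (sub_index S) L) : word I L :=
  [ffun i => if insub i is Some s then w s else c i].

(** A uniform word stays uniform when its letters on [S] are resampled: exchanging these letters
    with [w] is an involution of the pairs [(c, w)]. *)
Lemma avg_mix (I L : finType) (S : pred I) (a0 : L) (f : word I L -> R) :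
  avg f = avg (fun c => avg (fun w => f (mix (S := S) c w))).
Proof.
rewrite -(avg_pair (fun p => f (mix p.1 p.2))).
pose h (p : word I L * word (sub_index S) L) :
    word I L * word (sub_index S) L := (mix p.1 p.2, [ffun s => p.1 (val s)]).
have hK : involutive h.
  move=> [c w]; rewrite /h /=; congr pair; apply/ffunP => i; rewrite !ffunE.
    by case: insubP => // s _ <-; rewrite ffunE.
  by rewrite valK.
rewrite (eq_avg (g := (fun p => f p.1) \o h))// avg_bij; last exact: inv_bij.
rewrite avg_pair; apply: eq_avg => x /=.
by rewrite (avg_cst [ffun=> a0]).
Qed.

Lemma sub_index_card (I : finType) (S : pred I) :
  #|sub_index S| = #|[pred i | S i]|.
Proof. exact: card_sig. Qed.

Lemma geometric_small (q : R) e : 0 <= q -> q < 1 -> 0 < e ->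
  exists n0, forall n, (n0 <= n)%N -> q ^+ n <= e.
Proof.
move=> q0 q1 e0.
have /cvgrPdist_le/(_ e e0) : ((fun n => q ^+ n) @ \oo --> (0 : R))%classic.
  by apply: cvg_expr; rewrite ger0_norm.
case=> n0 _ h; exists n0; move=> n nn; have := h n nn.
by rewrite sub0r normrN ger0_norm// exprn_ge0.
Qed.

Lemma avg_prod (I W : finType) (g : W -> R) :
  avg (fun x : word I W => \prod_i g (x i)) = avg g ^+ #|I|.
Proof.
rewrite /avg expr_div_n card_ffun natrX; congr (_ / _).
by rewrite -(bigA_distr_bigA (fun _ : I => g)) prodr_const.
Qed.

(* Lower tail of a binomial variable, through its exponential moment. *)
Lemma few_hits (W : finType) m e : 0 < e -> exists n0, forall (I : finType),
  (n0 <= #|I|)%N -> forall F : pred W, (exists o, F o) ->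
  avg (fun x : word I W => (#|[pred i | F (x i)]| < m)%N%:R) <= e.
Proof.
move=> e0.
have [W0|W0] := posnP #|W|.
  exists 0%N; move=> I _ F [w _]; suff : (0 < #|W|)%N by rewrite W0.
  by apply/card_gt0P; exists w.
have W0' : (0 < #|W|%:R :> R) by rewrite ltr0n.
pose q : R := 1 - (2 * #|W|%:R)^-1.
have q0 : 0 <= q.
  rewrite subr_ge0 invf_le1 ?mulr_gt0//.
  by rewrite -natrM ler1n muln_gt0.
have q1 : q < 1 by rewrite ltrBlDr ltrDl invr_gt0 mulr_gt0.
have [n0 hn] := geometric_small q0 q1 (divr_gt0 e0 (exprn_gt0 m (ltr0n R 2 : 0 < 2))).
exists n0; move=> I nI F [w Fw].
pose g (x : W) : R := if F x then 2^-1 else 1.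
have ge0 x : 0 <= g x by rewrite /g; case: ifP.
have gavg : avg g <= q.
  have -> : avg g = avg (fun x => 1 - 2^-1 * (F x)%:R).
    by apply: eq_avg => x; rewrite /g; case: (F x) => /=; lra.
  rewrite avgB (avg_cst w) lerD2l lerN2 avgZ invfM ler_wpM2l//.
  have := @avg_ge_term R W (fun x => (F x)%:R) w (fun=> ler0n _ _).
  by rewrite Fw /= mul1r.
apply: (@le_trans _ _ (2 ^+ m * q ^+ #|I|)); last first.
  by rewrite mulrC -ler_pdivlMr ?exprn_gt0// hn.
apply: (@le_trans _ _ (2 ^+ m * avg g ^+ #|I|)); last first.
  by rewrite ler_wpM2l ?exprn_ge0// lerXn2r ?nnegrE// avg_ge0.
rewrite -avg_prod -avgZ; apply: le_avg => x.
have -> : \prod_i g (x i) = 2^-1 ^+ #|[pred i | F (x i)]|.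
  rewrite /g -big_mkcond /= prodr_const; congr (_ ^+ _).
case: ltnP => /= c; last by rewrite mulr_ge0// exprn_ge0.
rewrite exprVn ler_pdivlMr ?exprn_gt0// mul1r ler_eXn2l ?ltr1n//.
exact: ltnW.
Qed.

(** Iterated [option], so that an induction on a dimension or on an alphabet size adds the single
    element [None]. *)
Fixpoint Dim (n : nat) : finType :=
  if n is n'.+1 then option (Dim n') : finType else void : finType.

Lemma card_Dim n : #|Dim n| = n.
Proof. by elim: n => [|n IH] /=; rewrite ?card_void// card_option IH. Qed.

End Words.

(** * Insensitive sets *)

Section Insensitive.
Variable R : realType.
Local Notation avg := (@avg R _).
Local Notation dens := (@dens R _ _).

Lemma sum_ge_ex (J : finType) (j0 : J) (f : J -> R) c :
  c <= \sum_j f j -> exists j, c / #|J|%:R <= f j.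
Proof.
move=> cf; apply: (avg_ge_ex j0).
by rewrite ler_wpM2r ?invr_ge0 ?ler0n.
Qed.

Definition join_tpl (I1 I2 D L : finType) (phi : {ffun I1 -> D + L})
    (psi : {ffun I2 -> D + L}) : {ffun I1 + I2 -> D + L} :=
  [ffun i => match i with inl i => phi i | inr i => psi i end].

Definition const_tpl (I D L : finType) (u : word I L) : {ffun I -> D + L} :=
  [ffun i => inr (u i)].

Lemma subst_join (I1 I2 D L : finType) (phi : {ffun I1 -> D + L})
    (psi : {ffun I2 -> D + L}) v :
  subst (join_tpl phi psi) v = join (subst phi v) (subst psi v).
Proof. by apply/ffunP => -[] i; rewrite !ffunE. Qed.

Lemma subst_const (I D L : finType) (u : word I L) (v : word D L) :
  subst (const_tpl D u) v = u.
Proof. by apply/ffunP => i; rewrite !ffunE. Qed.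

Lemma nondeg_joinl (I1 I2 D L : finType) (phi : {ffun I1 -> D + L})
    (psi : {ffun I2 -> D + L}) : nondeg phi -> nondeg (join_tpl phi psi).
Proof.
move=> /nondegP h; apply/nondegP => j; have [i ij] := h j.
by exists (inl i); rewrite ffunE.
Qed.

Lemma nondeg_joinr (I1 I2 D L : finType) (phi : {ffun I1 -> D + L})
    (psi : {ffun I2 -> D + L}) : nondeg psi -> nondeg (join_tpl phi psi).
Proof.
move=> /nondegP h; apply/nondegP => j; have [i ij] := h j.
by exists (inr i); rewrite ffunE.
Qed.

Lemma dens_reindex (I J L : finType) (f : I -> J) (A : pred (word I L)) :
  bijective f -> dens (fun w => A (subst (reindex_tpl L f) w)) = dens A.
Proof.
move=> fb; rewrite /dens.
exact: (@avg_bij R (word J L) (word I L) _ (fun w => (A w)%:R)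
          (subst_reindex_bij L fb)).
Qed.

Lemma dens_join (I1 I2 L : finType) (A : pred (word (I1 + I2)%type L)) :
  dens A = avg (fun y => dens (fun x => A (join x y))).
Proof. by rewrite /dens avg_join avg_exchange. Qed.

(** Induction on [d]. For many words [y] on the second block, the section of [A] at [y] has a line
    on the first block. By pigeonhole one line [w] serves a positive density of the [y], and these
    [y] contain a [d]-dimensional subspace; the wildcard of [w] is the additional direction. *)
Lemma multidim_DHJ (L : finType) (a0 : L) :
  (forall delta : R, 0 < delta -> DHJ L delta) ->
  forall d delta, 0 < delta -> exists N, forall I : finType, (N <= #|I|)%N ->
  forall A : pred (word I L), delta <= dens A ->
  exists phi : {ffun I -> Dim d + L}, nondeg phi /\ forall v, A (subst phi v).
Proof.
move=> dhj; elim=> [|d IH] delta d0.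
  exists 0%N; move=> I _ A hA.
  have [|w Aw] := @avg_gt_ex R _ (fun w : word I L => (A w)%:R) 0 (lexx _).
    exact: lt_le_trans hA.
  exists (const_tpl _ w); split; first by apply/nondegP => -[].
  by move=> v; rewrite subst_const; move: Aw; case: (A w) => //=; rewrite ltxx.
have d20 : 0 < delta / 2 by rewrite divr_gt0.
have [N1 hN1] := dhj _ d20.
pose K : R := ((#|L|.+1) ^ N1)%:R.
have K0 : 0 < K by rewrite ltr0n expn_gt0.
have [N2 hN2] := IH (delta / 2 / K) (divr_gt0 d20 K0).
exists (N1 + N2)%N; move=> I hI A hA.
have [I1 [I2 [f [fb cI1 cI2]]]] := split_index (leq_trans (leq_addr N2 N1) hI).
pose A' (w : word (I1 + I2)%type L) := A (subst (reindex_tpl L f) w).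
have := hA; rewrite -(dens_reindex A fb) -/A' dens_join.
rewrite [delta]splitr => /avg_markov - /(_ (ltW d20) (fun=> dens_le1 _ _)) h.
pose g (w : word I1 (option L)) (y : word I2 L) : bool :=
  [exists i, w i == None] && [forall a, A' (join (fill a w) y)].
have {h} : delta / 2 <= \sum_w avg (fun y => (g w y)%:R).
  rewrite -avg_sum; apply: le_trans h _; apply: le_avg => y.
  have [|_] /= := boolP (delta / 2 <= dens (fun x => A' (join x y)));
    last by apply: sumr_ge0 => w _; rewrite ler0n.
  move=> /hN1; rewrite cI1 => /(_ (leqnn _)) /existsP[w hw].
  rewrite (bigD1 w)//= /g hw /= lerDl; apply: sumr_ge0 => w' _.
  by rewrite ler0n.
move=> /(sum_ge_ex [ffun=> None]) [w].
rewrite card_ffun card_option cI1 -/K => hw.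
have wN : [exists i, w i == None].
  apply: contraT => nw; move: hw; rewrite leNgt => /negP; case.
  apply: le_lt_trans (divr_gt0 d20 K0).
  by apply: avg_le_cst => // y; rewrite /g (negbTE nw).
pose B (y : word I2 L) := [forall a, A' (join (fill a w) y)].
have hB : delta / 2 / K <= dens B.
  by apply: le_trans hw _; apply: le_avg => y; rewrite /g wN.
have [|psi [npsi Bpsi]] := hN2 I2 _ B hB.
  by rewrite cI2 leq_subRL// (leq_trans _ hI)// leq_addr.
pose phi : {ffun I1 + I2 -> Dim d.+1 + L} := [ffun i => match i with
  | inl i => if w i is Some a then inr a else inl None
  | inr i => match psi i with inl j => inl (Some j) | inr a => inr a end end].
exists (comp_tpl (reindex_tpl L f) phi); split.
  apply: nondeg_comp; first exact: nondeg_reindex.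
  apply/nondegP => -[j|].
    have /nondegP/(_ j)[i ij] := npsi.
    by exists (inr i); rewrite ffunE ij.
  have /existsP[i /eqP wi] := wN.
  by exists (inl i); rewrite ffunE wi.
move=> v; rewrite subst_comp -/(A' _).
have -> : subst phi v =
    join (fill (v None) w) (subst psi [ffun j => v (Some j)]).
  apply/ffunP => -[] i; rewrite !ffunE; first by case: (w i).
  by case: (psi i) => // j; rewrite ffunE.
by have /forallP := Bpsi [ffun j => v (Some j)].
Qed.

Variable L : finType.
Local Notation Lo := (option L).

Definition collapse (a : L) (c : Lo) : Lo := if c == Some a then None else c.

(** Invariance under the single map [collapse a] amounts to invariance under arbitrary exchanges of
    [Some a] and [None], since words differing by such exchanges collapse to the same word. *)
Definition insensitive (I : finType) (a : L) (E : pred (word I Lo)) :=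
  forall w : word I Lo, E [ffun i => collapse a (w i)] = E w.

Lemma insensitive_eq (I : finType) (a : L) (E : pred (word I Lo))
    (w w' : word I Lo) :
  insensitive a E -> (forall i, collapse a (w i) = collapse a (w' i)) ->
  E w = E w'.
Proof.
move=> iE ww; rewrite -[LHS]iE -[RHS]iE; congr (E _).
by apply/ffunP => i; rewrite !ffunE.
Qed.

Lemma insensitive_subst (I D : finType) (a : L) (E : pred (word I Lo))
    (phi : {ffun I -> D + Lo}) :
  insensitive a E -> insensitive a (fun v => E (subst phi v)).
Proof.
move=> iE v; apply: insensitive_eq iE _ => i.
rewrite !ffunE; case: (phi i) => // j; rewrite ffunE /collapse.
by case vj: (v j == Some a); rewrite ?vj.
Qed.

Hypothesis dhj : forall delta : R, 0 < delta -> DHJ L delta.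

(* Letters other than [Some a] form a copy of [L], with [None] in the place of
   [a].  Since [L]-words are not uniformly distributed among the words of the
   larger alphabet, the positions of the letter [Some a] are frozen first. *)
Lemma insensitive_subspace (a : L) d (eta : R) : 0 < eta ->
  exists M, forall I : finType, (M <= #|I|)%N ->
  forall E : pred (word I Lo), insensitive a E -> eta <= dens E ->
  exists phi : {ffun I -> Dim d + Lo}, nondeg phi /\ forall v, E (subst phi v).
Proof.
move=> e0; have e20 : 0 < eta / 2 by rewrite divr_gt0.
have [M0 hM0] := multidim_DHJ a dhj d e20.
have [M hM] := few_hits Lo M0 (divr_gt0 e20 (ltr0n R 2 : 0 < 2)).
exists M; move=> I hI E iE hE.
pose emb (z : L) : Lo := if z == a then None else Some z.
pose tau (x : Lo) (z : L) : Lo := if x == Some a then x else emb z.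
pose sig (x : Lo) (z : L) : L := if x == Some a then z else odflt a x.
have emba z : (emb z == Some a) = false.
  by rewrite /emb; case: (eqVneq z a) => // za; apply: negbTE.
have embK z : odflt a (emb z) = z.
    by rewrite /emb; case: (eqVneq z a) => [->|].
have Kemb x : x != Some a -> emb (odflt a x) = x.
  case: x => [x|] /=; last by rewrite /emb eqxx.
  by rewrite /emb => xa; case: (eqVneq x a) xa => // ->; rewrite eqxx.
(* [h] exchanges the letters of the two words wherever the first is not [Some a]. It preserves the
   uniform distribution of the pairs, and for a fixed first word it puts a uniform [L]-word,
   embedded by [emb], at these positions. *)
pose h (p : word I Lo * word I L) : word I Lo * word I L :=
  ([ffun i => tau (p.1 i) (p.2 i)], [ffun i => sig (p.1 i) (p.2 i)]).
have hK : involutive h.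
  move=> [x z]; rewrite /h /=; congr pair; apply/ffunP => i; rewrite !ffunE /tau /sig.
    by case: (eqVneq (x i) (Some a)) => [->|xa]; rewrite ?eqxx// emba Kemb.
  by case: (eqVneq (x i) (Some a)) => [->|xa]; rewrite ?eqxx// emba embK.
have hE2 : dens E =
    avg (fun x : word I Lo => avg (fun z : word I L => (E (h (x, z)).1)%:R)).
  rewrite -(avg_pair (fun p => (E (h p).1)%:R)).
  rewrite (eq_avg (g := (fun p => (E p.1)%:R) \o h))// avg_bij; last exact: inv_bij.
  by rewrite avg_pair; apply: eq_avg => x /=; rewrite (avg_cst [ffun=> a]).
pose F (c : Lo) := c != Some a.
pose few (x : word I Lo) : bool := (#|[pred i | F (x i)]| < M0)%N.
have hfew : avg (fun x : word I Lo => (few x)%:R) <= eta / 2 / 2.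
  by apply: hM => //; exists None.
have [x] : exists x : word I Lo, eta / 2 <
    avg (fun z : word I L => (E (h (x, z)).1)%:R) - (few x)%:R.
  apply: avg_gt_ex; first exact: ltW.
  by rewrite avgB -hE2; lra.
case: (boolP (few x)) => [_|].
  have : avg (fun z : word I L => (E (h (x, z)).1)%:R) <= 1.
    by apply: avg_le_cst => // z; rewrite lern1 leq_b1.
  by move=> h1 h2; exfalso; move: h1 h2 => /=; lra.
rewrite /few -leqNgt -sub_index_card => cS; rewrite subr0.
set S := (fun i => F (x i)) in cS.
rewrite (avg_mix S a).
move=> /(avg_gt_ex (ltW e20)) [c hc].
pose E2 (w : word (sub_index S) L) := E (h (x, mix c w)).1.
have [psi [npsi Epsi]] := hM0 (sub_index S) cS E2 (ltW hc).
pose phi : {ffun I -> Dim d + Lo} := [ffun i =>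
  if insub i is Some s then
    match psi s with inl j => inl j | inr b => inr (emb b) end
  else inr (Some a)].
exists phi; split.
  apply/nondegP => j; have /nondegP/(_ j)[s sj] := npsi.
  by exists (val s); rewrite ffunE valK sj.
(* [E] sees [v] only up to [collapse a], that is, through the [L]-word [t]; so a subspace over [L]
   yields one over all of [Lo]. *)
move=> v; pose t : word (Dim d) L := [ffun j => odflt a (v j)].
rewrite (_ : E (subst phi v) = E2 (subst psi t)); first exact: Epsi.
have cemb y : collapse a (emb (odflt a y)) = collapse a y.
  case: (eqVneq y (Some a)) => [->|ya]; last by rewrite Kemb.
  by rewrite /emb /collapse /= !eqxx.
apply: insensitive_eq iE _ => i; rewrite !ffunE /=.
case: insubP => [s Fs si|]; last first.
  by rewrite /F negbK => /eqP xi; rewrite /tau xi eqxx.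
rewrite /tau ffunE (negbTE Fs : (x i == Some a) = false).
by case: (psi s) => // j; rewrite ffunE cemb.
Qed.

End Insensitive.

(** * Density increments on insensitive sets and their intersections *)

Section Increment.
Variable R : realType.
Local Notation avg := (@avg R _).
Local Notation dens := (@dens R _ _).
Variable L : finType.
Local Notation Lo := (option L).
Hypothesis dhj : forall delta : R, 0 < delta -> DHJ L delta.

Lemma avg_reindex (I J : finType) (f : I -> J) (g : word I Lo -> R) :
  bijective f -> avg (fun w => g (subst (reindex_tpl Lo f) w)) = avg g.
Proof.
move=> fb; exact: (@avg_bij R (word J Lo) (word I Lo) _ g
  (subst_reindex_bij Lo fb)).
Qed.

Lemma avg_image (I D : finType) (phi : {ffun I -> D + Lo})
    (f : word I Lo -> R) :
  nondeg phi ->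
  avg (fun u : word I Lo => [exists v, u == subst phi v]%:R * f u) =
  #|word D Lo|%:R / #|word I Lo|%:R * avg (fun v => f (subst phi v)).
Proof.
move=> nphi; rewrite /avg.
have W0 : #|word D Lo|%:R != 0 :> R.
  by rewrite pnatr_eq0 -lt0n; apply/card_gt0P; exists [ffun=> None].
rewrite [RHS]mulrC mulrA divfK//; congr (_ / _).
have inj : {in predT &, injective (subst phi)} by move=> v v' _ _; exact: subst_inj.
rewrite -(big_imset f inj) [RHS]big_mkcond /=; apply: eq_bigr => u _.
have -> : (u \in imset (subst phi) (mem predT)) = [exists v, u == subst phi v].
  by apply/imsetP/existsP => [[v _ ->]|[v /eqP ->]]; exists v.
by case: ifP; rewrite ?mul1r ?mul0r.
Qed.

(* Greedy partition of a set with insensitive sections into subspaces, in dual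
   form: instead of recording the pieces, the mass of [h] is tracked.  A popular
   subspace of the first block is removed at each step, which lowers the density
   by [c]; the removed part is a union of subspaces, and the rest still has
   insensitive sections over the enlarged parameter space [X * word I1 Lo]. *)
Lemma insensitive_increment_step (a : L) d (eta : R) : 0 < eta ->
  exists2 c, 0 < c & forall r : nat, exists N,
  forall I : finType, (N <= #|I|)%N ->
  forall (X : finType) (E : X -> pred (word I Lo)) (h : X -> word I Lo -> R),
    (forall x, insensitive a (E x)) -> (forall x w, h x w <= 1) ->
    avg (fun x => dens (E x)) <= eta + r%:R * c ->
    eta < avg (fun x => avg (fun w => (E x w)%:R * h x w)) ->
    exists x (phi : {ffun I -> Dim d + Lo}),
      nondeg phi /\ 0 < avg (fun v => h x (subst phi v)).
Proof.
move=> e0; have e20 : 0 < eta / 2 by rewrite divr_gt0.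
have [M hM] := insensitive_subspace dhj a d e20.
pose nT : R := ((d + #|L|.+1) ^ M)%:R.
pose nW : R := (#|L|.+1 ^ M)%:R.
have nT0 : 0 < nT by rewrite ltr0n expn_gt0 addnS.
have nW0 : 0 < nW by rewrite ltr0n expn_gt0.
(* Lower bound for the density removed in one step: a popular template is chosen among [nT], and its
   image has density at least [1 / nW] in the first block. *)
pose c := eta / 2 / nT / nW.
have c0 : 0 < c by rewrite !divr_gt0.
exists c => //.
(* As [h <= 1], mass above [eta] forces density above [eta], which refutes the case [r = 0]. *)
have small (X I : finType) (E : X -> pred (word I Lo)) h :
    (forall x w, h x w <= 1) ->
    avg (fun x => avg (fun w => (E x w)%:R * h x w)) <= avg (fun x => dens (E x)).
  move=> h1; apply: le_avg => x; apply: le_avg => w.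
  by case: (E x w); rewrite ?mul1r ?mul0r.
elim=> [|r [N IH]].
  exists 0%N; move=> I _ X E h _ h1 hE hh; exfalso.
  by have := small _ _ E h h1; lra.
exists (M + N)%N; move=> I hI X E h iE h1 hE hh.
have [I1 [I2 [f [fb cI1 cI2]]]] := split_index (leq_trans (leq_addr N M) hI).
have fn := nondeg_reindex Lo fb.
pose rf := subst (reindex_tpl Lo f).
pose E1 x w := E x (rf w).
pose h' x w := h x (rf w).
have iE1 x : insensitive a (E1 x) by exact: insensitive_subst.
pose tpl : finType := {ffun I1 -> Dim d + Lo}.
pose G (phi : tpl) x (y : word I2 Lo) : bool :=
  nondeg phi && [forall v, E1 x (join (subst phi v) y)].
have E1avg : avg (fun x => dens (E x)) =
    avg (fun x => avg (fun y => dens (fun u => E1 x (join u y)))).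
  by apply: eq_avg => x; rewrite -dens_join -(dens_reindex R (E x) fb).
have hG : eta / 2 <= \sum_phi avg (fun x => avg (fun y => (G phi x y)%:R)).
  rewrite -avg_sum; under eq_avg do rewrite -avg_sum.
  have := small _ _ E h h1; rewrite E1avg => hs.
  have : eta / 2 + eta / 2 <= avg (fun p : X * word I2 Lo =>
      dens (fun u => E1 p.1 (join u p.2))).
    by rewrite avg_pair -splitr; apply: le_trans hs; exact: ltW.
  move=> /avg_markov - /(_ (ltW e20) (fun=> dens_le1 _ _)).
  rewrite avg_pair /= => /le_trans; apply.
  apply: le_avg => x; apply: le_avg => y /=.
  have [|_] /= := boolP (eta / 2 <= dens (fun u => E1 x (join u y))); last first.
    by apply: sumr_ge0 => phi _; rewrite ler0n.
  have iEy : insensitive a (fun u => E1 x (join u y)).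
    move=> u; apply: insensitive_eq (iE1 x) _ => -[] i; rewrite !ffunE //.
    by rewrite /collapse; case ui: (u i == Some a); rewrite ?ui.
  move=> /hM - /(_ _ iEy); rewrite cI1 => /(_ (leqnn _)) [phi [nphi Ephi]].
  rewrite (bigD1 phi)//= {1}/G nphi /= (introT forallP Ephi) lerDl.
  by apply: sumr_ge0 => phi' _; rewrite ler0n.
have tpl0 : tpl by exact: [ffun=> inr None].
have [phi] := sum_ge_ex tpl0 hG.
rewrite card_ffun card_sum card_Dim card_option cI1 -/nT => hphi.
apply: contrapT => nex.
have nphi : nondeg phi.
  apply: contraT => nn; move: hphi; rewrite leNgt => /negP; case.
  apply: le_lt_trans (divr_gt0 e20 nT0).
  apply: avg_le_cst => // x; apply: avg_le_cst => // y.
  by rewrite /G (negbTE nn).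
(* By [nex] the mean of [h'] on every copy of [phi] is nonpositive, so removing copies does not
   decrease the mass. *)
have bad x y : avg (fun v => h' x (join (subst phi v) y)) <= 0.
  rewrite leNgt; apply/negP => hxy; apply: nex; exists x.
  exists (comp_tpl (reindex_tpl Lo f) (join_tpl phi (const_tpl _ y))).
  split; first by apply: nondeg_comp => //; exact: nondeg_joinl.
  by under eq_avg do rewrite subst_comp subst_join subst_const.
pose im (u : word I1 Lo) := [exists v, u == subst phi v].
pose E2 (p : X * word I1 Lo) (y : word I2 Lo) : bool :=
  E1 p.1 (join p.2 y) && ~~ (G phi p.1 y && im p.2).
pose h2 (p : X * word I1 Lo) (y : word I2 Lo) := h' p.1 (join p.2 y).
have E2E x u y : (E2 (x, u) y)%:R =
    (E1 x (join u y))%:R - (G phi x y)%:R * (im u)%:R :> R.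
  rewrite /E2 /=; case: (boolP (G phi x y)) => [/andP[_ /forallP Gxy]|_] /=; last first.
    by rewrite andbT mul0r subr0.
  case: (boolP (im u)) => [/existsP[v /eqP ->]|_] /=; last first.
    by rewrite andbT mulr0 subr0.
  by rewrite Gxy mulr1 subrr.
have iE2 p : insensitive a (E2 p).
  case: p => x u y; rewrite /E2 /=.
  have jE u' : E1 x (join u' [ffun i => collapse a (y i)]) = E1 x (join u' y).
    apply: insensitive_eq (iE1 x) _ => -[] i; rewrite !ffunE //.
    by rewrite /collapse; case yi: (y i == Some a); rewrite ?yi.
  rewrite jE; congr (_ && ~~ (_ && _)).
  by rewrite /G; congr (_ && _); apply: eq_forallb => v; rewrite jE.
have densE2 : avg (fun p => dens (E2 p)) <= eta + r%:R * c.
  have -> : avg (fun p => dens (E2 p)) = avg (fun x => dens (E x)) -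
      avg (fun x => avg (fun y => (G phi x y)%:R)) * avg (fun u => (im u)%:R).
    rewrite E1avg avg_pair -avgZr -avgB; apply: eq_avg => x.
    rewrite avg_exchange -avgZr -avgB; apply: eq_avg => y.
    by rewrite -avgZ -avgB; apply: eq_avg => u; rewrite E2E.
  have im_ge : nW^-1 <= avg (fun u => (im u)%:R).
    have := @avg_ge_term R _ (fun u => (im u)%:R)
      (subst phi [ffun=> None]) (fun=> ler0n _ _).
    have -> : im (subst phi [ffun=> None]).
      by apply/existsP; exists [ffun=> None].
    by rewrite mul1r card_ffun card_option cI1.
  have : c <= avg (fun x => avg (fun y => (G phi x y)%:R)) *
      avg (fun u => (im u)%:R).
    by apply: ler_pM => //; rewrite ?invr_ge0 ?ltW// !divr_gt0.
  by move: hE; rewrite -natr1 mulrDl mul1r; lra.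
have hh2 : eta < avg (fun p => avg (fun y => (E2 p y)%:R * h2 p y)).
  have -> : avg (fun p => avg (fun y => (E2 p y)%:R * h2 p y)) =
      avg (fun x => avg (fun w => (E x w)%:R * h x w)) -
      avg (fun x => avg (fun y => (G phi x y)%:R *
        avg (fun u => (im u)%:R * h' x (join u y)))).
    rewrite avg_pair -avgB; apply: eq_avg => x.
    rewrite -(avg_reindex _ fb) avg_join.
    under [X in _ = _ - X]eq_avg do rewrite -avgZ.
    rewrite [X in _ = _ - X]avg_exchange -avgB; apply: eq_avg => u.
    rewrite -avgB; apply: eq_avg => y.
    by rewrite E2E mulrBl mulrA.
  apply: lt_le_trans hh _; rewrite lerDl oppr_ge0.
  apply: avg_le_cst => // x; apply: avg_le_cst => // y.
  rewrite (avg_image (fun u => h' x (join u y)) nphi).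
  by rewrite mulr_ge0_le0// mulr_ge0_le0// divr_ge0.
have [||p [psi [npsi hpsi]]] := IH I2 _ _ E2 h2 iE2 _ densE2 hh2.
  by rewrite cI2 leq_subRL// (leq_trans _ hI)// leq_addr.
  by move=> [x u] y; exact: h1.
apply: nex; exists p.1.
exists (comp_tpl (reindex_tpl Lo f) (join_tpl (const_tpl _ p.2) psi)).
split; first by apply: nondeg_comp => //; exact: nondeg_joinr.
by under eq_avg do rewrite subst_comp subst_join subst_const.
Qed.

(** With a one-point parameter space and [r * c >= 1], the density bound required by the iteration
    is automatic. *)
Lemma insensitive_increment (a : L) d (eta : R) : 0 < eta ->
  exists N, forall I : finType, (N <= #|I|)%N ->
  forall (E : pred (word I Lo)) (h : word I Lo -> R),
    insensitive a E -> (forall w, h w <= 1) ->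
    eta < avg (fun w => (E w)%:R * h w) ->
    exists phi : {ffun I -> Dim d + Lo},
      nondeg phi /\ 0 < avg (fun v => h (subst phi v)).
Proof.
move=> e0; have [c c0 H] := insensitive_increment_step a d e0.
have [r hr] : exists r : nat, 1 <= r%:R * c.
  exists (Num.bound c^-1); rewrite -ler_pdivrMr// mul1r ltW//.
  by apply: archi_boundP; rewrite invr_ge0 ltW.
have [N HN] := H r; exists N; move=> I hI E h iE h1 hh.
have [||x [phi [nphi hphi]]] := HN I hI unit (fun=> E) (fun=> h) (fun=> iE)
  (fun=> h1).
- by rewrite (avg_cst tt); have := dens_le1 R E; lra.
- by rewrite (avg_cst tt).
by exists phi.
Qed.

Definition cell (I : finType) (H : L -> pred (word I Lo)) (w : word I Lo) :=
  [forall a, H a w].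

(** Induction on the letters: on a subspace found for one [H b], the remaining sets are still
    insensitive and still correlate with [g], and the next subspace is taken inside it. *)
Lemma insensitive_cell_increment d (eta : R) : 0 < eta ->
  exists N, forall I : finType, (N <= #|I|)%N ->
  forall (H : L -> pred (word I Lo)) (g : word I Lo -> R),
    (forall a, insensitive a (H a)) -> (forall w, g w <= 1) ->
    eta < avg (fun w => (cell H w)%:R * g w) ->
    exists (D : finType) (phi : {ffun I -> D + Lo}),
      [/\ (d <= #|D|)%N, nondeg phi & 0 < avg (fun v => g (subst phi v))].
Proof.
move=> e0; suff [N HN] : exists N, forall I : finType, (N <= #|I|)%N ->
    forall (H : L -> pred (word I Lo)) (g : word I Lo -> R),
    (forall a, insensitive a (H a)) -> (forall w, g w <= 1) ->
    eta < avg (fun w => (all (H^~ w) (enum L))%:R * g w) ->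
    exists (D : finType) (phi : {ffun I -> D + Lo}),
      [/\ (d <= #|D|)%N, nondeg phi & 0 < avg (fun v => g (subst phi v))].
  exists N; move=> I hI H g iH g1 hg; apply: (HN I hI H g iH g1).
  rewrite (lt_le_trans hg)// le_eqVlt; apply/orP; left; apply/eqP/eq_avg => w.
  congr (_%:R * _); congr nat_of_bool; apply/forallP/allP => h a //.
  by apply: h; rewrite mem_enum.
elim: (enum L) eta e0 => [|b s IH] eta e0.
  exists d; move=> I hI H g iH g1 hg.
  exists I, (reindex_tpl Lo id); split => //.
    by apply: nondeg_reindex; exact: inv_bij.
  rewrite (avg_reindex g (inv_bij (fun=> erefl))).
  by apply: lt_trans e0 _; apply: lt_le_trans hg _; apply: le_avg => w; rewrite mul1r.
have e20 : 0 < eta / 2 by rewrite divr_gt0.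
have [N1 HN1] := IH _ e20.
have [N HN] := insensitive_increment b N1 e20.
exists N; move=> I hI H g iH g1 hg.
(* Half of [eta] is subtracted beforehand, so that a positive mean of [h] on a subspace is a
   correlation above [eta / 2] there. *)
pose h w := (all (H^~ w) s)%:R * g w - eta / 2.
have h1 w : h w <= 1.
  rewrite /h; have := g1 w.
  by case: (all _ _); rewrite ?mul1r ?mul0r => gw; lra.
have hh : eta / 2 < avg (fun w => (H b w)%:R * h w).
  have : avg (fun w => (all (H^~ w) (b :: s))%:R * g w - eta / 2) <=
      avg (fun w => (H b w)%:R * h w).
    apply: le_avg => w; rewrite /h /=.
    by case: (H b w) => /=; rewrite ?mul1r ?mul0r//; lra.
  by rewrite avgB (avg_cst [ffun=> None]); lra.
have [phi [nphi hphi]] := HN I hI _ h (iH b) h1 hh.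
have cN1 : (N1 <= #|Dim N1|)%N by rewrite card_Dim.
have iHphi c : insensitive c (fun w => H c (subst phi w)).
  exact: insensitive_subst.
have [|D [psi [dD npsi hpsi]]] := HN1 _ cN1 (fun c w => H c (subst phi w))
  (fun w => g (subst phi w)) iHphi (fun w => g1 _).
  by move: hphi; rewrite /h avgB (avg_cst [ffun=> None]); lra.
exists D, (comp_tpl phi psi); split => //; first exact: nondeg_comp.
by under eq_avg do rewrite subst_comp.
Qed.

(* The complement of an intersection of insensitive sets is the disjoint union of
   the cells on which a given [P b] is the first to fail. *)
Lemma insensitive_compl_increment d (eta : R) : 0 < eta ->
  exists N, forall I : finType, (N <= #|I|)%N ->
  forall (P : L -> pred (word I Lo)) (g : word I Lo -> R),
    (forall a, insensitive a (P a)) -> (forall w, g w <= 1) ->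
    #|L|%:R * eta < avg (fun w => (~~ cell P w)%:R * g w) ->
    exists (D : finType) (phi : {ffun I -> D + Lo}),
      [/\ (d <= #|D|)%N, nondeg phi & 0 < avg (fun v => g (subst phi v))].
Proof.
move=> e0; have [N HN] := insensitive_cell_increment d e0.
exists N; move=> I hI P g iP g1.
pose H0 : L -> pred (word I Lo) := fun _ _ => true.
have -> : avg (fun w => (~~ cell P w)%:R * g w) = avg (fun w =>
    (cell H0 w)%:R * (~~ all (P^~ w) (enum L))%:R * g w).
  apply: eq_avg => w; have -> : cell H0 w by apply/forallP.
  rewrite mul1r; congr ((~~ _)%:R * _); apply/forallP/allP => h a //.
  by apply: h; rewrite mem_enum.
rewrite cardE; have : forall a, insensitive a (H0 a) by [].
elim: (enum L) H0 => [|b s IH] H iH.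
  rewrite mul0r => h; exfalso; move: h; rewrite ltNge => /negP; apply.
  by apply: avg_le_cst => // w; rewrite mulr0 mul0r.
move=> hs.
pose H' (Q : pred (word I Lo)) a w := H a w && ((a == b) ==> Q w).
have H'E Q w : cell (H' Q) w = cell H w && Q w.
  apply/forallP/andP => [h|[/forallP h1 h2] a].
    split; first by apply/forallP => a; have /andP[] := h a.
    by have /andP[_] := h b; rewrite eqxx.
  by rewrite /H' h1; apply/implyP.
have iH' Q : insensitive b Q -> forall a, insensitive a (H' Q a).
  move=> iQ a w; rewrite /H' iH; congr (_ && _).
  by case: eqP => //= ->; rewrite iQ.
have iN : insensitive b (fun w => ~~ P b w) by move=> w; rewrite iP.
(* Either the cell on which [P b] fails has mass above [eta], or more than [eta] times the number of
   remaining letters is left where [P b] holds. *)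
case: (ltP eta (avg (fun w => (cell (H' (fun w => ~~ P b w)) w)%:R * g w))) => h.
  exact: (HN I hI _ g (iH' _ iN) g1 h).
apply: (IH (H' (P b))); first exact: iH'.
move: hs; rewrite (eq_avg (g := fun w =>
  (cell (H' (fun w => ~~ P b w)) w)%:R * g w +
  (cell (H' (P b)) w)%:R * (~~ all (P^~ w) s)%:R * g w)).
  by rewrite avgD /= -natr1 mulrDl mul1r; lra.
move=> w; rewrite !H'E /=.
by case: (cell H w); case: (P b w); case: (all _ _);
  rewrite /= ?mul1r ?mul0r ?mulr0 ?mul0r ?addr0 ?add0r.
Qed.

End Increment.

(** * The density Hales-Jewett theorem *)

Section DensityHalesJewett.
Variable R : realType.
Local Notation avg := (@avg R _).
Local Notation dens := (@dens R _ _).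

(** The deficits [b - f y] are nonnegative and add up to at most [#|T| * s], which bounds each of
    them. *)
Lemma avg_all_ge (T : finType) (f : T -> R) b s x :
  (forall y, f y <= b) -> b - s <= avg f -> b - #|T|%:R * s <= f x.
Proof.
move=> fb fs.
have fx : (b - f x) / #|T|%:R <= avg (fun y => b - f y).
  by apply: avg_ge_term => y; rewrite subr_ge0.
have T0 : 0 < #|T|%:R :> R by rewrite ltr0n; apply/card_gt0P; exists x.
move: fx; rewrite avgB (avg_cst x) ler_pdivrMr// => fx.
have : (b - avg f) * #|T|%:R <= s * #|T|%:R by rewrite ler_wpM2r ?ler0n//; lra.
lra.
Qed.

(** * The induction step on the alphabet *)

Section Step.
Variables (L : finType) (a0 : L).
Local Notation Lo := (option L).
Hypothesis dhj : forall delta : R, 0 < delta -> DHJ L delta.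

(** [fill a w] viewed in the larger alphabet: the point at the letter [a] of the [L]-line [w]. *)
Definition fillS (I : finType) (a : L) (w : word I Lo) : word I Lo :=
  [ffun i => Some (odflt a (w i))].

Lemma insensitive_fillS (I : finType) a (A : pred (word I Lo)) :
  insensitive a (fun w => A (fillS a w)).
Proof.
move=> w; congr (A _); apply/ffunP => i; rewrite !ffunE /collapse.
by case: eqP => // ->.
Qed.

(* The line has wildcard set [w^-1(None)]; its point at the letter [None] is [w]. *)
Lemma line_of_fillS (I : finType) (A : pred (word I Lo)) (w : word I Lo) :
  (exists i, w i = None) -> A w -> (forall a, A (fillS a w)) -> has_line A.
Proof.
move=> [i wi] Aw AS; apply/has_lineP.
exists [ffun i => if w i is Some b then Some (Some b) else None]; split.
  by exists i; rewrite ffunE wi.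
case=> [a|].
  rewrite (_ : fill _ _ = fillS a w)//.
  by apply/ffunP => k; rewrite !ffunE; case: (w k).
rewrite (_ : fill _ _ = w)//.
by apply/ffunP => k; rewrite !ffunE; case: (w k).
Qed.

Lemma line_free_dens (I : finType) (A : pred (word I Lo)) delta N :
  (forall I : finType, (N <= #|I|)%N ->
    forall A : pred (word I Lo), delta <= dens A -> has_line A) ->
  ~~ has_line A ->
  forall (D : finType) (phi : {ffun I -> D + Lo}), (N <= #|D|)%N ->
  nondeg phi -> dens (fun v => A (subst phi v)) < delta.
Proof.
move=> hN nA D phi ND nphi; rewrite ltNge; apply/negP => /(hN D ND).
by move=> /(has_line_subst nphi); exact/negP.
Qed.

(* Let [ds] be the critical density.  All sections of a line-free set of density
   near [ds] have density near [ds], so points can be sampled from any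
   distribution.  Letting [c] be uniform over [Lo] and [j] uniform over [J], the
   words [i |-> if c i is None then v (j i) else c i] form a random [J]-space of
   [L]-words, which contains a line [u] by [dhj].  For fixed [u], the letters of
   the resulting line at the positions with [u (j i) = None] are just those of
   [c], hence uniform. *)
Lemma many_lines (ds : R) : 0 < ds ->
  (forall nu, 0 < nu -> DHJ Lo (ds + nu)) ->
  (forall nu, 0 < nu -> ~ DHJ Lo (ds - nu)) ->
  exists2 c1, 0 < c1 & forall kappa m, 0 < kappa ->
  exists (D : finType) (A : pred (word D Lo)),
    [/\ (m <= #|D|)%N, ~~ has_line A, ds - kappa <= dens A &
        c1 <= dens (fun w => [forall a, A (fillS a w)])].
Proof.
move=> ds0 above below.
have d40 : 0 < ds / 4 by rewrite divr_gt0.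
have [M hM] := dhj d40.
(* The successor makes [J], hence [word I1 J], inhabited. *)
pose J := Dim M.+1.
pose c0 := ds / 4 / #|word J Lo|%:R.
have c00 : 0 < c0.
  by rewrite divr_gt0// ltr0n; apply/card_gt0P; exists [ffun=> None].
pose c1 := c0 / 4.
have c10 : 0 < c1 by rewrite divr_gt0.
exists c1 => // kappa m k0.
(* The first bound serves the final count over [y]; the second keeps the sections of [A] denser than
   [ds / 2]. *)
pose eps := Num.min (c1 * kappa / 4) (ds / 4).
have eps0 : 0 < eps by rewrite lt_min !divr_gt0// mulr_gt0.
have eps1 : eps <= c1 * kappa / 4 by rewrite ge_min lexx.
have eps2 : eps <= ds / 4 by rewrite ge_min lexx orbT.
have [Nb hNb] := above _ eps0.
have [n1 hn1] := few_hits J (maxn m Nb) c10.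
pose Kn : R := (#|L|.+1 ^ n1)%:R.
have Kn0 : 0 < Kn by rewrite ltr0n expn_gt0.
(* There are [Kn] sections over the first block: a mean deficit of at most [2 * nu] bounds each
   single deficit by [Kn * (2 * nu) = eps]. *)
pose nu := eps / (2 * Kn).
have nu0 : 0 < nu by rewrite divr_gt0// mulr_gt0.
have [N3 hN3] := above _ nu0.
have [I [A [hI hA nA]]] : exists (I : finType) (A : pred (word I Lo)),
    [/\ (n1 + N3 <= #|I|)%N, ds - nu <= dens A & ~~ has_line A].
  apply: contrapT => nex; apply: (below _ nu0); exists (n1 + N3)%N => I hI A hA.
  by apply: contraT => nA; exfalso; apply: nex; exists I, A.
have [I1 [I2 [f [fb cI1 cI2]]]] := split_index (leq_trans (leq_addr N3 n1) hI).
pose A' (w : word (I1 + I2)%type Lo) := A (subst (reindex_tpl Lo f) w).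
have nA' : ~~ has_line A'.
  by apply: contra nA; exact: has_line_subst (nondeg_reindex _ fb).
have {hA} hA' : ds - nu <= dens A' by rewrite dens_reindex.
pose At t y := A' (join t y).
have Atlt t : dens (At t) < ds + nu.
  have := line_free_dens hN3 nA' (phi := join_tpl (const_tpl I2 t) (reindex_tpl Lo id)).
  rewrite (_ : dens (At t) = dens (fun v =>
    A' (subst (join_tpl (const_tpl I2 t) (reindex_tpl Lo id)) v))).
    apply; first by rewrite cI2 leq_subRL// (leq_trans _ hI)// leq_addr.
    by apply: nondeg_joinr; apply: nondeg_reindex; exact: inv_bij.
  apply: eq_avg => y; rewrite /At subst_join subst_const.
  by congr (A' (join _ _))%:R; apply/ffunP => i; rewrite !ffunE.
have Atge t : ds - eps <= dens (At t).
  have := @avg_all_ge _ (fun t => dens (At t)) (ds + nu) (2 * nu) t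
    (fun t => ltW (Atlt t)).
  rewrite card_ffun card_option cI1 -/Kn (_ : Kn * (2 * nu) = eps); last first.
    by rewrite mulrCA mulrA mulrC; apply: divfK; rewrite gt_eqF// mulr_gt0.
  rewrite -(avg_join (fun w => (A' w)%:R)) => h; apply: le_trans (h _); first lra.
  by move: hA'; rewrite /dens; lra.
pose U (j : word I1 J) (c : word I1 Lo) (v : word J Lo) : word I1 Lo :=
  [ffun i => if c i is Some b then Some b else v (j i)].
pose good (u : word J Lo) j c y : bool :=
  [exists i, u i == None] && [forall a, At (U j c (fillS a u)) y].
have hgood j c : ds / 4 <= avg (fun y => \sum_u (good u j c y)%:R).
  pose some (v : word J L) : word J Lo := [ffun i => Some (v i)].
  have : ds / 4 + ds / 4 <=
      avg (fun y => dens (fun v : word J L => At (U j c (some v)) y)).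
    rewrite avg_exchange; apply: (@le_trans _ _ (ds - eps)); first lra.
    rewrite -[leLHS](avg_cst ([ffun=> a0] : word J L)).
    by apply: le_avg => v; exact: Atge.
  move=> /avg_markov - /(_ (ltW d40) (fun=> dens_le1 _ _)) /le_trans; apply.
  apply: le_avg => y.
  have [|_] /= := boolP (ds / 4 <= dens (fun v => At (U j c (some v)) y));
    last by apply: sumr_ge0 => u _; rewrite ler0n.
  move=> /hM; rewrite card_Dim leqnSn => /(_ isT) /existsP[u /andP[u1 /forallP u2]].
  rewrite (bigD1 u)//= {1}/good u1 /= (_ : [forall a, _]).
    by rewrite lerDl; apply: sumr_ge0 => u' _; rewrite ler0n.
  apply/forallP => a; have := u2 a; congr (is_true (At (U j c _) y)).
  by apply/ffunP => i; rewrite !ffunE.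
have : ds / 4 <= \sum_u avg (fun j => avg (fun c => avg (fun y => (good u j c y)%:R))).
  rewrite -avg_sum -[leLHS](avg_cst ([ffun=> None] : word I1 J)).
  apply: le_avg => j; rewrite -avg_sum -[leLHS](avg_cst ([ffun=> None] : word I1 Lo)).
  by apply: le_avg => c; rewrite -avg_sum.
(* Pigeonhole over the lines of [J]-words: one [u] is good with density [c0], which depends neither
   on [kappa] nor on [m]. *)
move=> /(sum_ge_ex [ffun=> None]) [u]; rewrite -/c0 => hu.
have uN : [exists i, u i == None].
  apply: contraT => nu'; move: hu; rewrite leNgt => /negP; case.
  apply: le_lt_trans c00; apply: avg_le_cst => // j; apply: avg_le_cst => // c.
  by apply: avg_le_cst => // y; rewrite /good (negbTE nu').
pose few (j : word I1 J) : bool :=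
  (#|[pred i | u (j i) == None]| < maxn m Nb)%N.
have hfew : avg (fun j => (few j)%:R) <= c1.
  apply: (hn1 I1 _ (fun j => u j == None)); first by rewrite cI1.
  by have /existsP := uN.
have [j] : exists j, c0 / 2 <
    avg (fun c => avg (fun y => (good u j c y)%:R)) - (few j)%:R.
  apply: avg_gt_ex; first by rewrite ltW// divr_gt0.
  by rewrite avgB; move: hu hfew c00; rewrite /c1; lra.
case: (boolP (few j)) => [_|].
  have : avg (fun c => avg (fun y => (good u j c y)%:R)) <= 1.
    by apply: avg_le_cst => // c; apply: avg_le_cst => // y; rewrite lern1 leq_b1.
  by move=> h1 h2; exfalso; move: h1 h2 c00 => /=; lra.
rewrite /few -leqNgt subr0; set S := (fun i => u (j i) == None).
rewrite -[#|_|]/#|[pred i | S i]| -sub_index_card geq_max => /andP[mS NbS].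
rewrite (avg_mix S None) => /avg_gt_ex - /(_ _)[|c hc].
  by rewrite ltW// divr_gt0.
set D := sub_index S in mS NbS.
pose phi : {ffun I1 -> D + Lo} := [ffun i => if insub i is Some s then inl s
  else inr (if c i is Some b then Some b else u (j i))].
have nphi : nondeg phi by apply/nondegP => s; exists (val s); rewrite ffunE valK.
(* A position in [S] shows the letter of [w], with [a] in place of [None]; every other position is
   frozen by [c] or by [u]. *)
have Ufill a w : U j (mix c w) (fillS a u) = subst phi (fillS a w).
  apply/ffunP => i; rewrite !ffunE; case: insubP => [s Ss si|nS] /=.
    by rewrite ffunE; case: (w s) => //; rewrite (eqP Ss).
  by case: (c i) => //; move: nS; rewrite /S; case: (u (j i)).
pose Ay y w := A' (join (subst phi w) y).
have tplE (y : word I2 Lo) w :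
    subst (join_tpl phi (const_tpl D y)) w = join (subst phi w) y.
  by rewrite subst_join subst_const.
have ntpl (y : word I2 Lo) : nondeg (join_tpl phi (const_tpl D y)) by exact: nondeg_joinl.
have nAy y : ~~ has_line (Ay y).
  apply: contra nA' => h; apply: (has_line_subst (ntpl y)).
  by apply: etrans h; congr has_line; apply/funext => w; rewrite /Ay tplE.
have Aylt y : dens (Ay y) < ds + eps.
  have := line_free_dens hNb nA' NbS (ntpl y).
  by congr (_ < _); apply: eq_avg => w; rewrite /Ay tplE.
have Ayavg : ds - eps <= avg (fun y => dens (Ay y)).
  rewrite avg_exchange -[leLHS](avg_cst ([ffun=> None] : word D Lo)).
  by apply: le_avg => w; exact: Atge.
pose Dy y w := [forall a, Ay y (fillS a w)].
have : c1 + c1 <= avg (fun y => dens (Dy y)).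
  rewrite /c1 (_ : c0 / 4 + c0 / 4 = c0 / 2); last by lra.
  apply: le_trans (ltW hc) _; rewrite [leRHS]avg_exchange.
  apply: le_avg => w; apply: le_avg => y.
  rewrite ler_nat /good uN /= /Dy /Ay /At.
  by under eq_forallb do rewrite Ufill.
move=> /avg_markov - /(_ (ltW c10) (fun=> dens_le1 _ _)) hDy.
suff [y h1 h2] : exists2 y, c1 <= dens (Dy y) & ds - kappa <= dens (Ay y).
  by exists D, (Ay y).
apply: contrapT => nex.
(* Otherwise every [y] with many lines has a section of density below [ds - kappa]; no section
   exceeds [ds + eps], so the mean would drop below [ds - eps]. *)
have : avg (fun y => dens (Ay y)) <= avg (fun y =>
    (ds + eps) - (kappa + eps) * (c1 <= dens (Dy y))%R%:R).
  apply: le_avg => y; case: (boolP (c1 <= _)) => h /=; last first.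
    by rewrite mulr0 subr0 ltW.
  rewrite mulr1; have [h'|/ltW] := leP (ds - kappa) (dens (Ay y)); last lra.
  by exfalso; apply: nex; exists y.
rewrite avgB avgZ.
have := avg_le_cst (ltW (addr_gt0 ds0 eps0)) (fun _ : word I2 Lo => lexx (ds + eps)).
have : (kappa + eps) * c1 <= (kappa + eps) * avg (fun y => (c1 <= dens (Dy y))%R%:R).
  by rewrite ler_wpM2l// addr_ge0// ltW.
have : 0 < eps * c1 by rewrite mulr_gt0.
have : 0 < kappa * c1 by rewrite mulr_gt0.
lra.
Qed.

(** [ds] is the infimum of the densities at which the statement holds. It is positive because the
    statement fails at [delta] and, by monotonicity, below. The set is nonempty because density 2 is
    never attained. *)
Lemma critical_density (delta : R) : 0 < delta -> ~ DHJ Lo delta ->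
  exists2 ds : R, 0 < ds & (forall nu, 0 < nu -> DHJ Lo (ds + nu)) /\
  (forall nu, 0 < nu -> ~ DHJ Lo (ds - nu)).
Proof.
move=> d0 nd.
have mono (d d' : R) : DHJ Lo d -> d <= d' -> DHJ Lo d'.
  by move=> [N hN] dd; exists N => I hI A hA; apply: hN => //; exact: le_trans hA.
pose S := ([set d : R | DHJ Lo d])%classic.
have Slb : lbound S delta.
  by move=> d Sd; rewrite leNgt; apply/negP => /ltW/(mono _ _ Sd).
have S2 : S 2.
  exists 0%N => I _ A hA; exfalso; have := le_trans hA (dens_le1 R A).
  lra.
have infS : has_inf S by split; [exists 2|exists delta].
exists (inf S); last split.
- by apply: lt_le_trans d0 _; apply: lb_le_inf => //; exists 2.
- move=> nu nu0; have [e Se /ltW] := inf_adherent nu0 infS; exact: mono.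
move=> nu nu0 h; have := ge_inf infS.2 h; lra.
Qed.

Lemma DHJ_step (delta : R) : 0 < delta -> DHJ Lo delta.
Proof.
move=> d0; apply: contrapT => nd.
have [ds ds0 [above below]] := critical_density d0 nd.
have [c1 c10 H] := many_lines ds0 above below.
pose k : R := #|L|%:R.
have k0 : 0 <= k by rewrite ler0n.
(* Small enough for the gain [ds * c1], due to the density of [cell P], to outweigh a few error
   terms [kappa] and the threshold [k * kappa]. *)
pose kappa := ds * c1 / (8 * (k + 1)).
have kappa0 : 0 < kappa by rewrite divr_gt0 ?mulr_gt0// ltr_wpDl.
have kappaE : ds * c1 = 8 * kappa * k + 8 * kappa.
  by rewrite /kappa; field; rewrite gt_eqF// ltr_wpDl.
have [N hN] := above _ kappa0.
have [m0 hm0] := insensitive_compl_increment dhj N kappa0.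
have [m1 hm1] := few_hits Lo 1 kappa0.
have [D [A [mD nA hA hl]]] := H _ (maxn m0 m1) kappa0.
move: mD; rewrite geq_max => /andP[m0D m1D].
pose P a w := A (fillS a w).
(* A positive mean of [g] on a large subspace is a density above [ds + kappa] there, which a
   line-free set cannot have. *)
pose g w := (A w)%:R - (ds + kappa) : R.
have [w||D' [phi [ND nphi hphi]]] := hm0 D m0D P g (fun a => insensitive_fillS a A) _ _.
- by rewrite /g; case: (A w) => /=; lra.
- rewrite -/k.
  (* By [line_of_fillS] a word of [A] in [cell P] has no letter [None], and such words are rare. *)
  have few : avg (fun w => (A w && cell P w)%:R) <= kappa.
    have := hm1 D m1D (fun c => c == None) (ex_intro _ None (eqxx _)).
    apply: le_trans; apply: le_avg => w; rewrite ler_nat.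
    case: (boolP (A w && _)) => //= /andP[Aw /forallP Pw].
    rewrite lt0b ltnS leqn0; apply: contraT; rewrite -lt0n => /card_gt0P[i /eqP wi].
    by move: nA; rewrite (line_of_fillS _ Aw Pw)//; exists i.
  have -> : avg (fun w => (~~ cell P w)%:R * g w) =
      dens A - avg (fun w => (A w && cell P w)%:R) -
      (ds + kappa) * (1 - dens (cell P)).
    rewrite -[X in _ * (X - _)](avg_cst ([ffun=> None] : word D Lo)) -!avgB -avgZ -avgB.
    apply: eq_avg => w; rewrite /g.
    by case: (A w); case: (cell P w) => /=; lra.
  have hl' : c1 <= dens (cell P) by [].
  have : (ds + kappa) * (1 - dens (cell P)) <= (ds + kappa) * (1 - c1).
    by apply: ler_wpM2l; lra.
  have : 0 < kappa * c1 by rewrite mulr_gt0.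
  have : 0 <= kappa * k by rewrite mulr_ge0// ltW.
  lra.
have := line_free_dens hN nA ND nphi.
by move: hphi; rewrite /g avgB (avg_cst ([ffun=> None] : word D' Lo)) /dens; lra.
Qed.

End Step.

(** The induction starts with one letter: there is a single word, and it forms a line once there is
    a position. *)
Lemma DHJ_Dim k (delta : R) : 0 < delta -> DHJ (Dim k.+1) delta.
Proof.
elim: k delta => [|k IH] delta d0; last exact: (@DHJ_step (Dim k.+1) None).
exists 1%N => I hI A hA.
have [|w Aw] := @avg_gt_ex R _ (fun w : word I (Dim 1) => (A w)%:R) 0 (lexx _).
  exact: lt_le_trans hA.
have /card_gt0P[i _] := hI.
apply/has_lineP; exists [ffun=> None]; split; first by exists i; rewrite ffunE.
move=> a; rewrite (_ : fill _ _ = w).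
  by move: Aw; case: (A w) => //=; rewrite ltxx.
by apply/ffunP => k; rewrite !ffunE; case: a => [[]|]; case: (w k) => [[]|].
Qed.

Theorem density_Hales_Jewett (L : finType) (delta : R) :
  (0 < #|L|)%N -> 0 < delta -> DHJ L delta.
Proof.
move=> L0 d0; have [k cL] : exists k, #|L| = k.+1 by exists #|L|.-1; rewrite prednK.
have c : #|Dim k.+1| = #|L| by rewrite card_Dim cL.
pose f (a : Dim k.+1) : L := enum_val (cast_ord c (enum_rank a)).
pose g (b : L) : Dim k.+1 := enum_val (cast_ord (esym c) (enum_rank b)).
have fK : cancel f g by move=> a; rewrite /f /g enum_valK cast_ordK enum_rankK.
have gK : cancel g f by move=> b; rewrite /f /g enum_valK cast_ordKV enum_rankK.
have [N hN] := DHJ_Dim k d0; exists N => I hI A hA.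
pose F (w : word I (Dim k.+1)) : word I L := [ffun i => f (w i)].
have Fb : bijective F.
  exists (fun w : word I L => [ffun i => g (w i)]) => w; apply/ffunP => i;
    by rewrite !ffunE ?fK ?gK.
have := hN I hI (fun w => A (F w)).
rewrite (_ : dens _ = dens A); last exact: (@avg_bij R (word I (Dim k.+1))
  (word I L) F (fun w => (A w)%:R) Fb).
move=> /(_ hA) /has_lineP[w [[i wi] Aw]].
apply/has_lineP; exists [ffun i => omap f (w i)]; split.
  by exists i; rewrite ffunE wi.
move=> b; have := Aw (g b); congr (is_true (A _)).
by apply/ffunP => j; rewrite !ffunE; case: (w j) => [a|] //=; rewrite gK.
Qed.

End DensityHalesJewett.

(** * Multiple recurrence *)

Local Open Scope classical_set_scope.

Lemma big_option (V : nmodType) (U : finType) (F : option U -> V) :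
  \sum_k F k = F None + \sum_u F (Some u).
Proof.
rewrite (bigD1 None)//=; congr (_ + _).
rewrite (reindex_omap Some id) => [|[u|]]//=.
by apply: eq_bigl => u; rewrite eqxx.
Qed.

Section Recurrence.
Variables (R : realType) (disp : measure_display) (X : measurableType disp).
Variable mu : probability X R.

Lemma measurable_indic_comb (J : finType) (a : J -> R) (S : J -> set X) :
  (forall j, measurable (S j)) ->
  measurable_fun setT (fun x : X => (\sum_j a j * \1_(S j) x)%:E).
Proof.
move=> mS; apply/measurable_EFinP; apply: measurable_sum => j.
by apply: measurable_funM => //; exact: measurable_indic.
Qed.

Lemma integral_indic_comb (J : finType) (a : J -> R) (S : J -> set X) :
  (forall j, 0 <= a j) -> (forall j, measurable (S j)) ->
  (\int[mu]_x (\sum_j a j * \1_(S j) x)%:E)%E =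
  (\sum_j a j * fine (mu (S j)))%:E.
Proof.
move=> a0 mS; under eq_integral do rewrite -sumEFin.
rewrite ge0_integral_sum//; last 2 first.
- move=> j; apply/measurable_EFinP; apply: measurable_funM.
    exact: measurable_cst.
  exact: measurable_indic.
- by move=> j x _; rewrite lee_fin mulr_ge0.
rewrite -sumEFin; apply: eq_bigr => j _.
rewrite (integralZl_indic measurableT (fun=> S j))//; last first.
  by move=> aj; have := a0 j; rewrite leNgt aj.
by rewrite integral_indic// setIT EFinM fineK// fin_num_measure.
Qed.

Lemma le_measure_comb (J K : finType) (a : J -> R) (b : K -> R)
    (S : J -> set X) (S' : K -> set X) :
  (forall j, 0 <= a j) -> (forall k, 0 <= b k) ->
  (forall j, measurable (S j)) -> (forall k, measurable (S' k)) ->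
  (forall x, \sum_j a j * \1_(S j) x <= \sum_k b k * \1_(S' k) x) ->
  \sum_j a j * fine (mu (S j)) <= \sum_k b k * fine (mu (S' k)).
Proof.
move=> a0 b0 mS mS' SS'; rewrite -lee_fin -!integral_indic_comb//.
apply: ge0_le_integral => //.
- by move=> x _; rewrite lee_fin sumr_ge0// => j _; rewrite mulr_ge0.
- exact: measurable_indic_comb.
- exact: measurable_indic_comb.
- by move=> x _; rewrite lee_fin.
Qed.

Variables (d : nat) (T : 'rV[int]_d -> X -> X).
Hypothesis HT : Zd_system mu T.

Definition simplex (B : set X) (m : nat) : set X :=
  \bigcap_(i in [set: 'I_d]) (T (basis_vec i *+ m) @^-1` B).

Lemma measurable_translate u B : measurable B -> measurable (T u @^-1` B).
Proof.
move=> mB; rewrite -[_ @^-1` _]setTI; have [_ _ mT _] := HT.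
exact: mT.
Qed.

Lemma measurable_simplex B m : measurable B -> measurable (simplex B m).
Proof.
move=> mB; apply: fin_bigcap_measurable => // i _; exact: measurable_translate.
Qed.

Definition displacement (I : finType) (n : nat) (w : word I 'I_d) : 'rV[int]_d :=
  \sum_i basis_vec (w i) *+ n.

Lemma displacement_fill (I : finType) n (u : word I (option 'I_d)) :
  exists V, forall a, displacement n (fill a u) =
    basis_vec a *+ (n * #|[pred i | u i == None]|) + V.
Proof.
exists (\sum_(i | u i != None) (if u i is Some b then basis_vec b *+ n else 0)).
move=> a; rewrite /displacement (bigID (fun i => u i == None)) /=.
congr (_ + _); last first.
  by apply: eq_bigr => i; rewrite ffunE; case: (u i).
rewrite (eq_bigr (fun=> basis_vec a *+ n)) ?sumr_const ?mulrnA//.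
by move=> i /eqP ui; rewrite ffunE ui.
Qed.

(** The vectors of a line are those of a simplex shifted by one common [V], and [T V] preserves
    [mu]. *)
Lemma measure_line (I : finType) n (u : word I (option 'I_d)) B :
  measurable B ->
  mu (\bigcap_(a in [set: 'I_d]) (T (displacement n (fill a u)) @^-1` B)) =
  mu (simplex B (n * #|[pred i | u i == None]|)).
Proof.
move=> mB; have [V hV] := displacement_fill n u.
have [_ TD _ Tmu] := HT.
rewrite -[RHS](Tmu V); last exact: measurable_simplex.
congr (mu _); rewrite /simplex preimage_bigcap; apply: eq_bigcapr => a _.
by rewrite hV; apply/funext => x; rewrite /preimage /= TD.
Qed.

(** What matters is uniformity in [n]: [c] and [N] come from words of a fixed length, and only the
    displacements depend on [n]. *)
Lemma uniform_recurrence B : measurable B -> (0 < mu B)%E ->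
  exists (c : R) (N : nat), [/\ 0 < c, (0 < N)%N & forall n,
    c <= \sum_(1 <= r < N.+1) fine (mu (simplex B (n * r)))].
Proof.
move=> mB B0; have [d0|d0] := posnP d.
  exists 1, 1%N; split => // n; rewrite big_nat1.
  rewrite (_ : simplex _ _ = setT) ?probability_setT//.
  apply/seteqP; split => // x _ i; exfalso; suff : (0 < d)%N by rewrite d0.
    exact: leq_ltn_trans (ltn_ord i).
pose delta := fine (mu B).
have delta0 : 0 < delta.
  by rewrite fine_gt0// B0 ltey_eq fin_num_measure.
have [N hN] : DHJ 'I_d (delta / 2).
  by apply: density_Hales_Jewett; rewrite ?card_ord ?divr_gt0.
pose I : finType := 'I_N.+1.
pose W : finType := word I 'I_d.
pose U : finType := word I (option 'I_d).
have W0 : 0 < #|W|%:R :> R.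
  by rewrite ltr0n; apply/card_gt0P; exists [ffun=> Ordinal d0].
have U0 : 0 < #|U|%:R :> R.
  by rewrite ltr0n; apply/card_gt0P; exists [ffun=> None].
exists (delta / 2 / #|U|%:R), N.+1; split => //; first by rewrite !divr_gt0.
move=> n; pose E (w : W) := T (displacement n w) @^-1` B.
have mE w : measurable (E w) by exact: measurable_translate.
pose isline (u : U) := [exists i, u i == None].
pose line (u : U) : set X :=
  if isline u then \bigcap_(a in [set: 'I_d]) E (fill a u) else set0.
have mline u : measurable (line u).
  by rewrite /line; case: ifP => // _; exact: fin_bigcap_measurable.
(* Integral of a pointwise bound: the density of the words moving [x] into [B] is at most
   [delta / 2] plus the number of lines of such words. The index [None] carries the constant
   [delta / 2]. *)
have : \sum_(w : W) #|W|%:R^-1 * fine (mu (E w)) <=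
    \sum_(k : option U) (if k is Some _ then 1 else delta / 2) *
      fine (mu (if k is Some u then line u else setT)).
  apply: le_measure_comb => [w|[u|]|//|[u|] //|x].
  - by rewrite invr_ge0 ltW.
  - exact: ler01.
  - by rewrite divr_ge0// ltW.
  pose A : pred (word I 'I_d) := fun w => x \in E w.
  have -> : \sum_(w : W) #|W|%:R^-1 * \1_(E w) x = dens R A.
    by rewrite /dens /avg mulrC big_distrr.
  rewrite big_option /= indicT mulr1.
  have s0 : 0 <= \sum_(u : U) 1 * \1_(line u) x :> R.
    by apply: sumr_ge0 => u _; rewrite mul1r.
  have [h|/ltW h] := leP (delta / 2) (dens R A); last by rewrite ler_wpDr.
  apply: le_trans (dens_le1 _ _) _.
  have := hN I _ A h; rewrite card_ord leqnSn => /(_ isT) /has_lineP[u [[i ui] hu]].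
  rewrite (bigD1 u)//= mul1r indicE mem_set; last first.
    rewrite /line ifT; last by apply/existsP; exists i; apply/eqP.
    by move=> a _; have := hu a; rewrite inE.
  rewrite [1 + _]addrC addrA lerDr addr_ge0//; first by rewrite divr_ge0// ltW.
  by apply: sumr_ge0 => u' _; rewrite mul1r.
rewrite big_option /= probability_setT mulr1.
have [_ _ _ Tmu] := HT.
under eq_bigr do rewrite /E Tmu//.
rewrite sumr_const -[_ *+ _]mulr_natr mulrC mulrA divff ?gt_eqF// mul1r -/delta.
set f := fun m => fine (mu (simplex B m)).
have f0 m : 0 <= f m by rewrite fine_ge0.
have hline u : fine (mu (line u)) <= \sum_(1 <= r < N.+2) f (n * r)%N.
  rewrite /line; case: ifP => [/existsP[i ui]|_]; last first.
    by rewrite measure0 sumr_ge0.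
  rewrite measure_line//; set r := #|_|.
  have r0 : (0 < r)%N by apply/card_gt0P; exists i.
  have rN : (r < N.+2)%N by rewrite ltnS -[X in (_ <= X)%N]card_ord max_card.
  rewrite (big_cat_nat r0 (ltnW rN)) /= [X in _ + X]big_ltn//.
  by rewrite addrCA lerDl addr_ge0// sumr_ge0.
have : \sum_(u : U) 1 * fine (mu (line u)) <=
    #|U|%:R * \sum_(1 <= r < N.+2) f (n * r)%N.
  rewrite mulr_natl -sumr_const; apply: ler_sum => u _; rewrite mul1r; exact: hline.
by rewrite ler_pdivrMr// mulrC; lra.
Qed.

End Recurrence.

(** The multiples [n * r] are distinct and at most [N * P], so the left side is a partial sum of the
    right side. *)
Lemma sum_multiples_le (R : realType) (f : nat -> R) (r N P : nat) :
  (forall m, 0 <= f m) -> (0 < r <= N)%N ->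
  \sum_(1 <= n < P.+1) f (n * r)%N <= \sum_(1 <= m < (N * P).+1) f m.
Proof.
move=> f0 /andP[r0 rN].
have mono a b : (a <= b)%N -> \sum_(1 <= m < a.+1) f m <= \sum_(1 <= m < b.+1) f m.
  move=> ab; rewrite [leRHS](big_cat_nat (n := a.+1))//= lerDl.
  by apply: sumr_ge0.
apply: le_trans (mono (r * P)%N _ _); last by rewrite leq_mul2r rN orbT.
elim: P => [|P IH]; first by rewrite big_geq// big_geq// muln0.
rewrite big_nat_recr//= mulnC.
apply: (@le_trans _ _ (\sum_(1 <= m < (r * P).+1) f m + f (r * P.+1)%N)).
  by rewrite lerD2r.
have -> : (r * P.+1)%N = (r * P + r.-1).+1 by rewrite mulnS -addnS prednK// addnC.
by rewrite [leRHS]big_nat_recr//= lerD2r mono// leq_addr.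
Qed.

Theorem theorem4p1 (R : realType) (disp : measure_display)
  (X : measurableType disp) (mu : probability X R) (d : nat)
  (T : 'rV[int]_d -> X -> X)
  (HT : Zd_system mu T) (Hstd : standard_borel R X)
  (muF : {measure set (d.-tuple X) -> \bar R})
  (HF : furstenberg_joining mu T muF)
  (A : 'I_d -> set X) (mA : forall i, measurable (A i))
  (h0 : muF (rect A) = 0%E) :
  mu (\bigcap_(i in [set: 'I_d]) A i) = 0%E.
Proof.
set B := \bigcap_(i in _) A i.
have mB : measurable B by exact: fin_bigcap_measurable.
apply: contrapT => /eqP B0.
have {}B0 : (0 < mu B)%E by rewrite lt_def B0 measure_ge0.
have [c [N [c0 N0 hc]]] := uniform_recurrence HT mB B0.
pose f m := fine (mu (simplex T B m)).
have f0 m : 0 <= f m by rewrite fine_ge0.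
have N0' : 0 < N%:R :> R by rewrite ltr0n.
(* Summing the recurrence bound over [n] from 1 to [P] counts each [m] at most once for each of the
   [N] values of [r]. *)
have lower P : c / N%:R * P%:R <= \sum_(1 <= m < (N * P).+1) f m.
  rewrite mulrAC ler_pdivrMr//.
  apply: (@le_trans _ _ (\sum_(1 <= n < P.+1) \sum_(1 <= r < N.+1) f (n * r)%N)).
    rewrite mulr_natr -[P in leLHS]/(P.+1.-1) -subn1 -sumr_const_nat.
    by apply: ler_sum => n _; exact: hc.
  rewrite exchange_big /= mulr_natr -[X in _ *+ X]/(N.+1.-1) -subn1 -sumr_const_nat.
  by apply: ler_sum_nat => r rN; apply: sum_multiples_le.
have avg_ge P : (0 < P)%N -> c / N%:R / N%:R <= furstenberg_avg mu T A (N * P).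
  move=> P0; have P0' : 0 < P%:R :> R by rewrite ltr0n.
  rewrite /furstenberg_avg [leRHS]mulrC natrM ler_pdivlMr ?mulr_gt0//.
  rewrite mulrA divfK ?gt_eqF//.
  apply: le_trans (lower P) _; apply: ler_sum => m _.
  have mS : measurable (simplex T B m) by exact: (measurable_simplex HT).
  have mI : measurable (\bigcap_(i in [set: 'I_d]) (T (basis_vec i *+ m) @^-1` A i)).
    by apply: fin_bigcap_measurable => // i _; exact: (measurable_translate HT).
  apply: fine_le; rewrite ?fin_num_measure//; apply: le_measure; rewrite ?inE//.
  by move=> x hx i _; exact: (hx i I i I).
(* Along the multiples of [N] the averages stay above a positive constant, so they cannot tend to
   0. *)
have := HF A mA; rewrite h0 => /fine_cvgP[_ /cvgrPdist_lt/(_ (c / N%:R / N%:R))].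
move=> /(_ _)[|n0 _ /(_ (N * n0.+1)%N)]; first by rewrite !divr_gt0.
have := avg_ge n0.+1 isT => h /(_ _).
rewrite /= sub0r normrN => /(_ _) hlt.
have : `|furstenberg_avg mu T A (N * n0.+1)| < c / N%:R / N%:R.
  by apply: hlt; rewrite (leq_trans (leqnSn _))// leq_pmull.
by rewrite ltNge (le_trans h)// ler_norm.
Qed.
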